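(* (1) Let $(T_1,T_2)$ be a commuting pair of contraction operators on a Hilbert space $\mathcal H$, let $T=T_1T_2=T_2T_1$, and assume that the defect spaces $\mathcal D_T,\mathcal D_{T_1},\mathcal D_{T_2}$ are all finite-dimensional. Then $T=T_1\cdot T_2$ is a regular factorization if and only if $T=T_2\cdot T_1$ is a regular factorization. (2) In the infinite-dimensional setting this can fail: there exist a Hilbert space $\mathcal H$ and a commuting pair $(T_1,T_2)$ of contraction operators on $\mathcal H$ such that one of the two factorizations $T_1\cdot T_2$, $T_2\cdot T_1$ of $T=T_1T_2=T_2T_1$ is regular while the other is not regular.
   Context: For a contraction $A$ on a Hilbert space, $D_A=(I-A^*A)^{1/2}$ is its defect operator and $\mathcal D_A=\overline{\operatorname{Ran}}\,D_A$ its defect space. If $T=AB$ with $A,B$ contractions on $\mathcal H$, the formula $D_Th\mapsto D_{A}Bh\oplus D_{B}h$ ($h\in\mathcal H$) extends to an isometry from $\mathcal D_T$ into $\mathcal D_A\oplus\mathcal D_B$; the factorization $T=A\cdot B$ is called regular if this isometry is onto $\mathcal D_A\oplus\mathcal D_B$. *)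

(* Defs.v *)
From HB Require Import structures.
From mathcomp Require Import all_boot all_order all_algebra sesquilinear.
From mathcomp Require Import complex.
From mathcomp Require Import all_classical all_reals all_analysis.

Set Implicit Arguments.
Unset Strict Implicit.
Unset Printing Implicit Defensive.

Import Order.TTheory GRing.Theory Num.Theory.
Import numFieldNormedType.Exports.

Local Open Scope classical_set_scope.
Local Open Scope ring_scope.

(* Complex Hilbert spaces: complete normed spaces over R[i] whose norm comes
   from an inner product, which is linear in its first argument. *)
HB.mixin Record CompleteNormedModule_isHilbert (R : realType) H
    & CompleteNormedModule R[i] H := {
  hdot : {dot H for @Num.conj R[i]} ;
  hdot_norm : forall x : H, hdot x x = `|x| ^+ 2
}.

#[short(type="hilbertType")]
HB.structure Definition Hilbert (R : realType) :=
  {H of CompleteNormedModule R[i] H & CompleteNormedModule_isHilbert R H}.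

Section operators.
Context {R : realType} {H : hilbertType R}.
Implicit Types (A B P S : H -> H) (V : set H).

Definition contractive A : Prop := forall x, `|A x| <= `|x|.

(* [get] picks an element of the set. A bounded linear operator has exactly one
   adjoint; any B in this set is automatically linear and bounded. *)
Definition adjoint A : H -> H :=
  get [set B : H -> H | forall x y, hdot (A x) y = hdot x (B y)].

(* [0 <= z] in R[i] says that z is a nonnegative real, so over the complex
   scalars this implies that P is self-adjoint, hence bounded. *)
Definition positive_operator P : Prop :=
  linear P /\ forall x, 0 <= hdot (P x) x.

(* A positive operator has exactly one positive square root. *)
Definition operator_sqrt P : H -> H :=
  get [set S : H -> H | positive_operator S /\ S \o S =1 P].

Definition defect_operator A : H -> H :=
  operator_sqrt (fun x => x - adjoint A (A x)).

Definition defect_space A : set H := closure (range (defect_operator A)).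

(* For V a linear subspace: V is spanned by finitely many of its vectors. *)
Definition finite_dimensional V : Prop :=
  exists (n : nat) (e : 'I_n -> H),
    (forall i, V (e i)) /\
    (forall x, V x -> exists c : 'I_n -> R[i], x = \sum_(i < n) c i *: e i).

(* Z, restricted to the defect space of A \o B, is a linear isometry into the
   Hilbert direct sum of the defect spaces of A and B extending
   D_(AB) h |-> D_A B h (+) D_B h. The library's norm on H * H is the sup norm,
   so the norm of the direct sum is written out. As the range of D_(AB) is
   dense in its defect space, Z is uniquely determined there; its values
   elsewhere are irrelevant. *)
Definition is_factorization_isometry A B (Z : H -> H * H) : Prop :=
  let DT := defect_space (A \o B) in
  [/\ forall x, DT x -> (defect_space A `*` defect_space B) (Z x),
      forall (a : R[i]) (x y : H), DT x -> DT y ->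
        Z (a *: x + y) = a *: Z x + Z y,
      forall x, DT x -> `|(Z x).1| ^+ 2 + `|(Z x).2| ^+ 2 = `|x| ^+ 2
    & forall h, Z (defect_operator (A \o B) h)
        = (defect_operator A (B h), defect_operator B h) ].

Definition regular_factorization A B : Prop :=
  exists2 Z : H -> H * H, is_factorization_isometry A B Z
    & Z @` defect_space (A \o B) = defect_space A `*` defect_space B.

End operators.

(* Main.v *)
(* (1) The operator D_T h |-> (D_A B h, D_B h) always extends to an isometry of
   D_T, so when D_T is finite-dimensional it is onto exactly when the dimension
   of D_A (+) D_B equals that of D_T, a condition symmetric in A and B.
   Instead of dimensions: if Z for A.B is onto and Z' is the isometry for B.A,
   then Z^-1 composed with the flip of Z' is an injective linear map of D_T to
   itself, hence onto, and so Z' is onto.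
   (2) Take T1 = S, the unilateral shift on l^2, and T2 = 0. Then D_S = 0 and
   D_T = D_0 = I. For S.0 the isometry is h |-> 0 (+) h, which is onto; for 0.S
   it is h |-> S h (+) 0, which is not onto as S is not. *)
Require Import Defs.
From HB Require Import structures.
From mathcomp Require Import all_boot all_order all_algebra sesquilinear.
From mathcomp Require Import complex.
From mathcomp Require Import all_classical all_reals all_analysis.
From mathcomp Require Import ring lra.

Set Implicit Arguments.
Unset Strict Implicit.
Unset Printing Implicit Defensive.

Import Order.TTheory GRing.Theory Num.Theory.
Import numFieldNormedType.Exports.

Local Open Scope classical_set_scope.
Local Open Scope complex_scope.
Local Open Scope ring_scope.

(** [adjoint] and [operator_sqrt] are picked by [get], so nothing can be said of a defect operator
    until the sets they pick from are shown inhabited: adjoints come from Riesz representation,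
    square roots of I - A*A from a monotonically dominated iteration. The metric side then rests on
    the single identity ||D_A x||^2 = ||x||^2 - ||A x||^2. Telescoped through B it gives ||D_(AB)
    h||^2 = ||D_A B h||^2 + ||D_B h||^2, which is why the map of the overview is well defined and
    isometric. Finite dimension is given as a spanning family, so surjectivity of an injective
    endomorphism is obtained from a linear relation among the iterates y, f y, f (f y), ... In the
    example D_0 enters through D_0 D_0 = I, which already makes it bijective. *)

Section complex_parts.
Variable R : realType.
Implicit Types (t : R) (u v : R[i]).

Lemma Re_add u v : complex.Re (u + v) = complex.Re u + complex.Re v.
Proof. by case: u v => ? ? []. Qed.

Lemma Re_opp u : complex.Re (- u) = - complex.Re u.
Proof. by case: u. Qed.

Lemma Re_scale t u : complex.Re (t%:C * u) = t * complex.Re u.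
Proof. by case: u => a b /=; rewrite mul0r subr0. Qed.

Lemma Re_conj u : complex.Re (Num.conj u) = complex.Re u.
Proof. by case: u. Qed.

Lemma Re_mul_i u : complex.Re ('i%R * u) = - complex.Im u.
Proof. by rewrite -complexiE mulrC ReiNIm. Qed.

End complex_parts.

(** * Cauchy-Schwarz and triangle inequality for real semidefinite forms *)

Section form.
Variables (R : realType) (V : lmodType R[i]) (b : V -> V -> R).
Hypothesis bC : forall x y, b x y = b y x.
Hypothesis bD : forall x y z, b (x + y) z = b x z + b y z.
Hypothesis bZ : forall t x y, b (t%:C *: x) y = t * b x y.
Hypothesis b0 : forall x, 0 <= b x x.

Lemma form_sqrD x y : b (x + y) (x + y) = b x x + 2 * b x y + b y y.
Proof. rewrite bD (bC x) (bC y) !bD (bC y x); ring. Qed.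

(** The quadratic polynomial t |-> [b (x + t y) (x + t y)] is nonnegative on the reals. The form may
    be degenerate, so [b y y] = 0 is treated apart; this lets the lemma serve [l2_rdot] before l^2
    carries a norm. *)
Lemma form_cauchy_schwarz x y : b x y ^+ 2 <= b x x * b y y.
Proof.
have q t : 0 <= b x x + 2 * (t * b x y) + t ^+ 2 * b y y.
  by have := b0 (x + t%:C *: y); rewrite form_sqrD (bC x) !bZ
    (bC y (_ *: y)) bZ (bC y x) [t * (t * _)]mulrA -expr2.
have [y0|y0] := eqVneq (b y y) 0.
  rewrite y0 mulr0; have [->|xy] := eqVneq (b x y) 0; first by rewrite expr0n.
  (* The polynomial is now affine in t with nonzero slope; this t gives it the value -1. *)
  have := q (- (b x x + 1) / (2 * b x y)).
  rewrite y0 mulr0 addr0 [X in _ + X](_ : _ = - (b x x + 1)); last by field.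
  lra.
(* The minimizer of the polynomial. *)
have := q (- b x y / b y y).
have -> : b x x + 2 * (- b x y / b y y * b x y) + (- b x y / b y y) ^+ 2 * b y y =
    b x x - b x y ^+ 2 / b y y by field.
by rewrite subr_ge0 ler_pdivrMr// lt_def y0 b0.
Qed.

Lemma form_cauchy_schwarz_sqrt x y :
  `|b x y| <= Num.sqrt (b x x) * Num.sqrt (b y y).
Proof.
rewrite -(@ler_pXn2r _ 2) ?nnegrE ?mulr_ge0 ?sqrtr_ge0//.
by rewrite exprMn !sqr_sqrtr// real_normK ?num_real// form_cauchy_schwarz.
Qed.

Lemma form_triangle x y :
  Num.sqrt (b (x + y) (x + y)) <= Num.sqrt (b x x) + Num.sqrt (b y y).
Proof.
rewrite -(@ler_pXn2r _ 2) ?nnegrE ?addr_ge0 ?sqrtr_ge0//.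
rewrite sqrrD !sqr_sqrtr// form_sqrD lerD2r lerD2l
  -[_ * _ *+ 2]mulr_natl ler_pM2l//.
exact: le_trans (ler_norm _) (form_cauchy_schwarz_sqrt _ _).
Qed.

End form.

(** * Real-valued norm and inner product *)

Section real_structure.
Context {R : realType} {H : hilbertType R}.
Implicit Types (x y z : H) (t : R).

(* The order of R[i] is partial, so estimates are carried out in R. *)
Definition nrm x : R := complex.Re `|x|.
Definition rdot x y : R := complex.Re (hdot x y).

Lemma normE x : `|x| = (nrm x)%:C.
Proof. by rewrite /nrm RRe_real// normr_real. Qed.

Lemma nrm_ge0 x : 0 <= nrm x.
Proof. by rewrite -ler0c -normE. Qed.

Lemma nrm0 : nrm 0 = 0.
Proof. by rewrite /nrm normr0. Qed.

Lemma nrm_eq0 x : nrm x = 0 -> x = 0.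
Proof. by move=> x0; apply/normr0_eq0; rewrite normE x0. Qed.

Lemma nrm_triangle x y : nrm (x + y) <= nrm x + nrm y.
Proof. by rewrite -lecR rmorphD/= -!normE ler_normD. Qed.

Lemma nrmN x : nrm (- x) = nrm x.
Proof. by rewrite /nrm normrN. Qed.

Lemma nrmB x y : nrm (x - y) = nrm (y - x).
Proof. by rewrite -nrmN opprB. Qed.

Lemma nrmZ (a : R[i]) x : nrm (a *: x) = complex.Re `|a| * nrm x.
Proof.
by apply: complexI; rewrite rmorphM/= -!normE normrZ.
Qed.

Lemma nrmZr t x : nrm (t%:C *: x) = `|t| * nrm x.
Proof. by rewrite nrmZ normc_def/= expr0n/= addr0 sqrtr_sqr. Qed.

Lemma rdotC x y : rdot x y = rdot y x.
Proof. rewrite /rdot hermC expr0 mul1r; exact: Re_conj. Qed.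

Lemma rdotDl x y z : rdot (x + y) z = rdot x z + rdot y z.
Proof. rewrite /rdot linearDl; exact: Re_add. Qed.

Lemma rdotDr x y z : rdot z (x + y) = rdot z x + rdot z y.
Proof. by rewrite !(rdotC z) rdotDl. Qed.

Lemma rdotZl t x y : rdot (t%:C *: x) y = t * rdot x y.
Proof. rewrite /rdot linearZl_LR; exact: Re_scale. Qed.

Lemma rdotZr t x y : rdot x (t%:C *: y) = t * rdot x y.
Proof. by rewrite rdotC rdotZl rdotC. Qed.

Lemma rdotNl x y : rdot (- x) y = - rdot x y.
Proof. rewrite /rdot linearNl; exact: Re_opp. Qed.

Lemma rdotNr x y : rdot x (- y) = - rdot x y.
Proof. by rewrite rdotC rdotNl rdotC. Qed.

Lemma rdotBl x y z : rdot (x - y) z = rdot x z - rdot y z.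
Proof. by rewrite rdotDl rdotNl. Qed.

Lemma rdotBr x y z : rdot z (x - y) = rdot z x - rdot z y.
Proof. by rewrite rdotDr rdotNr. Qed.

Lemma rdotxx x : rdot x x = nrm x ^+ 2.
Proof. by rewrite /rdot hdot_norm normE -rmorphXn. Qed.

(** Multiplying the first argument by i turns the imaginary part into a real part, so identities for
    [hdot] reduce to identities for [rdot]. *)
Lemma Im_hdot x y : complex.Im (hdot x y) = - rdot ('i%R *: x) y.
Proof.
rewrite /rdot linearZl_LR; apply: oppr_inj; rewrite opprK; symmetry.
exact: Re_mul_i.
Qed.

Lemma rdotii x y : rdot ('i%R *: x) ('i%R *: y) = rdot x y.
Proof.
by rewrite /rdot linearZl_LR linearZr_LR/= conjCi mulrA mulrN -expr2 sqrCi
  opprK mul1r.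
Qed.

Lemma rdot_il x y : rdot ('i%R *: x) y = - rdot x ('i%R *: y).
Proof. by rewrite -rdotii scalerA -expr2 sqrCi scaleN1r rdotNl. Qed.

Lemma nrm_sqrD x y : nrm (x + y) ^+ 2 = nrm x ^+ 2 + 2 * rdot x y + nrm y ^+ 2.
Proof. rewrite -!rdotxx !rdotDl !rdotDr (rdotC y x); ring. Qed.

Lemma nrm_sqrB x y : nrm (x - y) ^+ 2 = nrm x ^+ 2 - 2 * rdot x y + nrm y ^+ 2.
Proof. rewrite nrm_sqrD nrmN rdotNr; ring. Qed.

Lemma rdot_cauchy_schwarz x y : `|rdot x y| <= nrm x * nrm y.
Proof.
have ge0 (z : H) : 0 <= rdot z z by rewrite rdotxx sqr_ge0.
have := form_cauchy_schwarz_sqrt rdotC rdotDl rdotZl ge0 x y.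
by rewrite !rdotxx !sqrtr_sqr !(ger0_norm (nrm_ge0 _)).
Qed.

Lemma hdot_eqP x y z w :
  rdot x y = rdot z w -> rdot ('i%R *: x) y = rdot ('i%R *: z) w ->
  hdot x y = hdot z w.
Proof.
move=> eRe eIm; apply/eqP; rewrite eq_complex; apply/andP; split; apply/eqP.
  exact: eRe.
by rewrite !Im_hdot eIm.
Qed.

End real_structure.

Lemma cvg_dist_le (R : realType) (a w : R^nat) (b : R) :
  (forall n, `|a n - b| <= w n) -> w @ \oo --> (0 : R) -> a @ \oo --> b.
Proof.
move=> le cw; have : (fun n => a n - b) @ \oo --> (0 : R).
  have cNw : (fun n => - w n) @ \oo --> (0 : R) by rewrite -[X in _ --> X]oppr0; exact: cvgN.
  apply: (@squeeze_cvgr _ _ _ _ (fun n => - w n) w) => //.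
  by near=> n; have := le n; rewrite ler_norml.
move=> c0; rewrite (_ : a = cst b \+ (fun n => a n - b)); last first.
  by apply/funext => n /=; rewrite subrKC.
by rewrite -[X in _ --> X]addr0; apply: cvgD => //; exact: cvg_cst.
Unshelve. all: by end_near. Qed.

(** * Convergence of sequences of vectors *)

Section convergence.
Context {R : realType} {H : hilbertType R}.
Implicit Types (x y z l : H) (u v : nat -> H) (t : R).

(** Norm convergence phrased as a limit of reals, so that squeezing and comparison of real sequences
    apply, whereas the radii of balls in [H] live in [R[i]]. *)
Definition cvs u l := (fun n => nrm (u n - l)) @ \oo --> (0 : R).

Lemma cvs_le u l (w : R^nat) :
  (forall n, nrm (u n - l) <= w n) -> w @ \oo --> (0 : R) -> cvs u l.
Proof.
by move=> le; apply: cvg_dist_le => n; rewrite subr0 ger0_norm ?nrm_ge0.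
Qed.

Lemma cvs_cst l : cvs (fun=> l) l.
Proof. by rewrite /cvs subrr nrm0; exact: cvg_cst. Qed.

Lemma cvsD u v x y : cvs u x -> cvs v y -> cvs (fun n => u n + v n) (x + y).
Proof.
move=> cu cv; apply: (@cvs_le _ _ (fun n => nrm (u n - x) + nrm (v n - y))).
  by move=> n; rewrite opprD addrACA nrm_triangle.
by rewrite -[0]addr0; exact: cvgD.
Qed.

Lemma cvs_lip u x (f : H -> H) (C : R) :
  (forall y, nrm (f y - f x) <= C * nrm (y - x)) -> cvs u x -> cvs (f \o u) (f x).
Proof.
move=> lip cu; apply: (@cvs_le _ _ (fun n => C * nrm (u n - x))) => [n|].
  exact: lip.
by rewrite -[X in _ --> X](mulr0 C); apply: cvgM => //; exact: cvg_cst.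
Qed.

Lemma cvsZ (a : R[i]) u x : cvs u x -> cvs (fun n => a *: u n) (a *: x).
Proof.
apply: (@cvs_lip _ _ ( *:%R a) (complex.Re `|a|)) => y.
by rewrite -scalerBr nrmZ.
Qed.

Lemma cvs_rdot u x y : cvs u x -> (fun n => rdot (u n) y) @ \oo --> rdot x y.
Proof.
move=> cu; apply: (@cvg_dist_le _ _ (fun n => nrm (u n - x) * nrm y)) => [n|].
  by rewrite -rdotBl rdot_cauchy_schwarz.
by rewrite -[X in _ --> X](mul0r (nrm y)); apply: cvgM => //; exact: cvg_cst.
Qed.

Lemma cvs_nrm u x : cvs u x -> (fun n => nrm (u n)) @ \oo --> nrm x.
Proof.
apply: cvg_dist_le => n.
have := nrm_triangle (u n) (x - u n); have := nrm_triangle (u n - x) x.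
by rewrite subrK subrKC (nrmB x) ler_norml => h1 h2; apply/andP; split; lra.
Qed.

Lemma cvs_unique u x y : cvs u x -> cvs u y -> x = y.
Proof.
move=> cx cy; apply/eqP; rewrite -subr_eq0; apply/eqP/nrm_eq0.
have : (fun n => nrm (u n - x) + nrm (u n - y)) @ \oo --> (0 : R).
  by rewrite -[X in _ --> X]addr0; exact: cvgD.
move=> c0; apply/eqP; rewrite eq_le nrm_ge0 andbT.
rewrite -(cvg_lim _ c0)//; apply: limr_ge; first by apply/cvg_ex; exists 0.
near=> n; apply: le_trans (_ : nrm ((x - u n) + (u n - y)) <= _).
  by rewrite addrA subrK.
by rewrite (nrmB (u n) x) nrm_triangle.
Unshelve. all: by end_near. Qed.

(** A positive element of [R[i]] is real, so complex radii and real radii give the same Cauchy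
    sequences. *)
Lemma hilbert_complete u :
  (forall e : R, 0 < e -> exists N, forall m n, (N <= m)%N -> (N <= n)%N ->
     nrm (u m - u n) < e) ->
  exists l, cvs u l.
Proof.
move=> cu; have : cvg (u @ \oo).
  apply: cauchy_cvg; apply: cauchy_exP => e e0.
  have [N hN] := cu (complex.Re e) ltac:(by move: e0; rewrite ltcE => /andP[]).
  exists (u N); exists N => // n /= Nn; rewrite -ball_normE/= normE.
  have -> : e = (complex.Re e)%:C by rewrite RRe_real// gtr0_real.
  by rewrite ltcR; exact: hN.
move=> /cvg_ex[l cl]; exists l; apply/cvgrPdist_lt => e e0.
move/cvgrPdist_lt : cl => /(_ e%:C); rewrite ltcR => /(_ e0) cl.
near=> n; rewrite sub0r normrN ger0_norm ?nrm_ge0// nrmB -ltcR -normE.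
by near: n.
Unshelve. all: by end_near. Qed.

End convergence.

Lemma cvg_ge0 (R : realType) (a : R^nat) (b : R) :
  (forall n, 0 <= a n) -> a @ \oo --> b -> 0 <= b.
Proof.
move=> a0 ab; rewrite -(cvg_lim _ ab)//; apply: limr_ge.
  by apply/cvg_ex; exists b.
exact: nearW.
Qed.

(** * Riesz representation and adjoints *)

Section riesz.
Context {R : realType} {H : hilbertType R}.
Variables (f : H -> R) (C : R).
Hypothesis fD : forall x y, f (x + y) = f x + f y.
Hypothesis fZ : forall t x, f (t%:C *: x) = t * f x.
Hypothesis fC : forall x, `|f x| <= C * nrm x.

Let J (x : H) := nrm x ^+ 2 - 2 * f x.

(* [J] attains its minimum exactly at the vector representing [f]; its
   minimizing sequences are Cauchy by the parallelogram law. *)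
Let parallelogram x y :
  nrm (x - y) ^+ 2 = 2 * J x + 2 * J y - 4 * J ((2^-1 : R)%:C *: (x + y)).
Proof.
have -> : J ((2^-1 : R)%:C *: (x + y)) = 4^-1 * nrm (x + y) ^+ 2 - (f x + f y).
  by rewrite /J fZ fD nrmZr exprMn real_normK ?num_real//; field.
by rewrite /J nrm_sqrB nrm_sqrD; field.
Qed.

Let JD x h t :
  J (x + t%:C *: h) = J x + (2 * t * (rdot x h - f h) + t ^+ 2 * nrm h ^+ 2).
Proof.
by rewrite /J fD fZ nrm_sqrD nrmZr exprMn real_normK ?num_real// rdotZr; ring.
Qed.

(** Stated for real-linear functionals and [rdot]; the complex statement is recovered by testing on
    both x and i x. *)
Lemma riesz_representation : exists z, forall x, f x = rdot z x.
Proof.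
have lbJ : has_lbound (range J).
  (* [J x] is at least r^2 - 2 C r = (r - C)^2 - C^2 with r = [nrm x]. *)
  exists (- C ^+ 2) => _ [x _ <-]; rewrite /J.
  have := fC x; rewrite ler_norml => /andP[_ h].
  have := sqr_ge0 (nrm x - C); nra.
have infJ : has_inf (range J) by split => //; exists (J 0), 0.
set m := inf (range J).
have mJ x : m <= J x by apply: ge_inf => //; exists x.
have /choice[u hu] (n : nat) : exists x, J x < m + n.+1%:R^-1.
  have [||_ [x _ <-] hx] := @inf_adherent _ (range J) n.+1%:R^-1; rewrite ?invr_gt0//.
  by exists x.
have cinv : (fun n => n.+1%:R^-1 : R) @ \oo --> (0 : R) by exact: cvg_harmonic.
have [z cz] : exists z, cvs u z.
  apply: hilbert_complete => e e0.
  (* Values of [J] below m + e^2/4 at two points, and at least m at their midpoint, bound the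
     squared distance by 4 (m + e^2/4) - 4 m = e^2. *)
  have e4 : 0 < e ^+ 2 / 4 by rewrite divr_gt0 ?exprn_gt0.
  have [N _ hN] := cvgr_lt _ cinv _ e4.
  exists N => i j Ni Nj; rewrite -(@ltr_pXn2r _ 2) ?nnegrE ?nrm_ge0 ?ltW//.
  rewrite parallelogram.
  have hi : J (u i) < m + e ^+ 2 / 4 by rewrite (lt_le_trans (hu i))// lerD2l ltW// hN.
  have hj : J (u j) < m + e ^+ 2 / 4 by rewrite (lt_le_trans (hu j))// lerD2l ltW// hN.
  move: hi hj (mJ ((2^-1 : R)%:C *: (u i + u j))).
  by move: (J _) (J _) (J _) => a b c; lra.
exists z => h.
(* Limit of [J (u n + t h)] >= m > [J (u n)] - 1/(n+1), written as a difference so that the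
   continuity of [J] is not invoked. *)
have var t : 0 <= 2 * t * (rdot z h - f h) + t ^+ 2 * nrm h ^+ 2.
  have /= := @cvg_ge0 R (fun n => n.+1%:R^-1 +
    (2 * t * (rdot (u n) h - f h) + t ^+ 2 * nrm h ^+ 2)).
  apply=> [n|].
    have := mJ (u n + t%:C *: h); have := hu n; rewrite JD.
    by move: (J _) (_%:R^-1) (2 * t * _) (t ^+ 2 * _) => a b c d; lra.
  rewrite -[X in _ --> X]add0r; apply: cvgD => //; apply: cvgD; last exact: cvg_cst.
  apply: cvgM; first exact: cvg_cst.
  by apply: cvgB; [exact: cvs_rdot | exact: cvg_cst].
pose s := nrm h ^+ 2; have s0 : 0 <= s by exact: sqr_ge0.
(* With this t the variation equals - t^2 (s + 2), which forces t = 0. The denominator s + 1 stays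
   positive even when h = 0. *)
pose t := - (rdot z h - f h) / (s + 1).
have ct : rdot z h - f h = - t * (s + 1).
  by rewrite /t -mulNr opprK divfK//; apply: lt0r_neq0; lra.
have := var t; rewrite ct -/s => vt.
have t2 : t ^+ 2 <= 0 by have := sqr_ge0 t; nra.
have t0 : t = 0 by apply/eqP; rewrite -sqrf_eq0 eq_le t2 sqr_ge0.
by move: ct; rewrite t0 oppr0 mul0r => /subr0_eq.
Qed.

End riesz.

Section adjoint.
Context {R : realType} {H : hilbertType R}.
Variable A : {linear H -> H}.
Hypothesis Acontr : contractive A.

Lemma contractive_nrm x : nrm (A x) <= nrm x.
Proof. by rewrite -lecR -!normE. Qed.

Lemma rdot_inj (x y : H) : (forall z, rdot z x = rdot z y) -> x = y.
Proof.
move=> xy; apply/eqP; rewrite -subr_eq0; apply/eqP/nrm_eq0.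
by apply/eqP; rewrite -sqrf_eq0 -rdotxx rdotBr xy subrr.
Qed.

(** Riesz applied to x |-> [rdot (A x) y], bounded by [nrm y], gives a candidate for the real part;
    complex linearity of [A] handles i x. Existence is what transfers the property to the element
    chosen by [get]. *)
Lemma hdot_adjoint x y : hdot (A x) y = hdot x (adjoint A y).
Proof.
have /choice[B hB] : forall y, exists z, forall x, rdot (A x) y = rdot z x.
  move=> {}y; apply: (@riesz_representation _ _ _ (nrm y)) => [u v|t u|u].
  - by rewrite linearD rdotDl.
  - by rewrite linearZ rdotZl.
  - apply: le_trans (rdot_cauchy_schwarz _ _) _.
    by rewrite mulrC ler_wpM2l ?nrm_ge0 ?contractive_nrm.
have : exists B : H -> H, forall x y, hdot (A x) y = hdot x (B y).
  exists B => u v; apply: hdot_eqP; first by rewrite hB rdotC.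
  by rewrite -linearZ hB rdotC.
by move=> /getPex; apply.
Qed.

Lemma rdot_adjoint x y : rdot (A x) y = rdot x (adjoint A y).
Proof. by rewrite /rdot hdot_adjoint. Qed.

Lemma adjoint_linear : linear (adjoint A).
Proof.
move=> a x y; apply: rdot_inj => z; rewrite rdotDr -!rdot_adjoint rdotDr.
by congr (_ + _); rewrite /rdot !linearZr_LR/= hdot_adjoint.
Qed.

Lemma nrm_adjoint x : nrm (adjoint A x) <= nrm x.
Proof.
have [->|y0] := eqVneq (nrm (adjoint A x)) 0; first exact: nrm_ge0.
have {}y0 : 0 < nrm (adjoint A x) by rewrite lt_def y0 nrm_ge0.
rewrite -(ler_pM2l y0) -expr2 -rdotxx -rdot_adjoint.
apply: le_trans (ler_norm _) _; apply: le_trans (rdot_cauchy_schwarz _ _) _.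
by rewrite ler_wpM2r ?nrm_ge0 ?contractive_nrm.
Qed.

End adjoint.

(** * Square roots of positive contractions *)

Section contraction_sqrt.
Context {R : realType} {H : hilbertType R}.
Variable X : H -> H.
Hypothesis Xlin : linear X.
Hypothesis Xsym : forall x y, rdot (X x) y = rdot x (X y).
Hypothesis Xle : forall x, nrm (X x) <= nrm x.

(* [1 - sqrt_iter n] tends to the square root of [1 - X]: its limit [Y] solves
   [2 Y = X + Y^2], that is, [(1 - Y)^2 = 1 - X]. *)
Fixpoint sqrt_iter n (x : H) : H :=
  if n is n.+1 then (2^-1 : R)%:C *: (X x + sqrt_iter n (sqrt_iter n x)) else 0.

(** The same recursion with [X] replaced by the number 1: a scalar majorant of the operator
    iteration, increasing and bounded by 1. *)
Fixpoint sqrt_iter_norm n : R :=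
  if n is n.+1 then 2^-1 * (1 + sqrt_iter_norm n ^+ 2) else 0.

Local Notation Y := sqrt_iter.
Local Notation r := sqrt_iter_norm.

Lemma sqrt_iter_linear n : linear (Y n).
Proof.
elim: n => [|n IH] a x y /=; first by rewrite scaler0 addr0.
rewrite Xlin !IH addrACA -scalerDr [LHS]scalerDr.
by congr (_ + _); rewrite !scalerA mulrC.
Qed.

Lemma sqrt_iter_sym n x y : rdot (Y n x) y = rdot x (Y n y).
Proof.
elim: n x y => [|n IH] x y /=.
  by rewrite -(scale0r 0) -[0](rmorph0 (real_complex R)) rdotZl rdotZr !mul0r.
by rewrite rdotZl rdotZr rdotDl rdotDr Xsym !IH.
Qed.

Lemma sqrt_iter_norm_bounds n : 0 <= r n <= 1 /\ r n <= r n.+1.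
Proof.
elim: n => [|n [/andP[r0 r1] rr]]; first by rewrite /= expr0n/= lexx; split; lra.
rewrite -[r n.+2]/(2^-1 * (1 + r n.+1 ^+ 2)).
have : r n.+1 = 2^-1 * (1 + r n ^+ 2) by [].
move: (r n) (r n.+1) r0 r1 rr => p q p0 p1 pq qE.
by split; [apply/andP; split|]; nra.
Qed.

Lemma nrm_sqrt_iter n x : nrm (Y n x) <= r n * nrm x.
Proof.
elim: n x => [|n IH] x /=; first by rewrite nrm0 mul0r.
have [/andP[r0 _] _] := sqrt_iter_norm_bounds n.
rewrite nrmZr ger0_norm ?invr_ge0// -mulrA ler_pM2l ?invr_gt0//.
apply: le_trans (nrm_triangle _ _) _; rewrite mulrDl mul1r lerD//.
by rewrite (le_trans (IH _))// expr2 -mulrA ler_wpM2l.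
Qed.

(** The difference Y'^2 - Y^2 of consecutive squares is split as Y' (Y' - Y) + (Y' - Y) Y, an
    identity valid without commutation, and the scalar difference is split the same way, so the two
    match term by term. *)
Lemma nrm_sqrt_iterS n x : nrm (Y n.+1 x - Y n x) <= (r n.+1 - r n) * nrm x.
Proof.
elim: n x => [|n IH] x.
  rewrite /= !subr0 addr0 expr0n/= addr0 mulr1 nrmZr ger0_norm ?invr_ge0//.
  by rewrite ler_pM2l ?invr_gt0.
have [/andP[r0 _] rr] := sqrt_iter_norm_bounds n.
have [/andP[r0' _] _] := sqrt_iter_norm_bounds n.+1.
have YB m u v : Y m (u - v) = Y m u - Y m v.
  by rewrite -[- v]scaleN1r addrC sqrt_iter_linear scaleN1r addrC.
have -> : Y n.+2 x - Y n.+1 x = (2^-1 : R)%:C *: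
    (Y n.+1 (Y n.+1 x - Y n x) + (Y n.+1 (Y n x) - Y n (Y n x))).
  rewrite YB addrA subrK -[Y n.+2 x]/(_ *: (_ + Y n.+1 (Y n.+1 x))).
  by rewrite [in X in _ - X]/= -scalerBr opprD addrACA subrr add0r.
have -> : r n.+2 - r n.+1 = 2^-1 * (r n.+1 * (r n.+1 - r n) + (r n.+1 - r n) * r n).
  transitivity (2^-1 * (1 + r n.+1 ^+ 2) - 2^-1 * (1 + r n ^+ 2)); first by [].
  by move: (r n.+1) (r n) => p q; ring.
rewrite nrmZr ger0_norm ?invr_ge0// -mulrA ler_pM2l ?invr_gt0//.
apply: le_trans (nrm_triangle _ _) _; rewrite mulrDl lerD//.
  by rewrite (le_trans (nrm_sqrt_iter _ _))// -mulrA ler_wpM2l.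
rewrite (le_trans (IH _))// -mulrA ler_wpM2l ?subr_ge0//.
exact: nrm_sqrt_iter.
Qed.

(** Increments are dominated by those of the bounded increasing scalar sequence; telescoping makes
    the orbit of x Cauchy. *)
Lemma sqrt_iter_cvg x : exists l, cvs (fun n => Y n x) l.
Proof.
have ndr : nondecreasing_seq r.
  by apply/nondecreasing_seqP => n; have [] := sqrt_iter_norm_bounds n.
have cr : cvgn r.
  apply: nondecreasing_is_cvgn ndr _; exists 1 => _ [n _ <-].
  by have [/andP[]] := sqrt_iter_norm_bounds n.
have YN N n : (N <= n)%N -> nrm (Y n x - Y N x) <= (r n - r N) * nrm x.
  move=> /subnK <-; elim: (n - N)%N => [|k IH]; first by rewrite !subrr nrm0 mul0r.
  rewrite addSn -(subrK (Y (k + N) x) (Y (k + N).+1 x)) -addrA.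
  apply: le_trans (nrm_triangle _ _) _; apply: le_trans (lerD (nrm_sqrt_iterS _ _) IH) _.
  by rewrite -mulrDl addrA subrK.
have cr0 : (fun n => (limn r - r n) * nrm x) @ \oo --> (0 : R).
  rewrite -[X in _ --> X](mul0r (nrm x)); apply: cvgM; last exact: cvg_cst.
  by rewrite -(subrr (limn r)); apply: cvgB => //; exact: cvg_cst.
apply: hilbert_complete => e e0.
have [N _ hN] := cvgr_lt _ cr0 _ (divr_gt0 e0 (ltr0n R 2)).
have {}hN n : (N <= n)%N -> nrm (Y n x - Y N x) < e / 2.
  move=> Nn; apply: le_lt_trans (hN N (leqnn N)).
  apply: le_trans (YN _ _ Nn) _; rewrite ler_wpM2r ?nrm_ge0// lerD2r.
  exact: nondecreasing_cvgn_le.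
exists N => m n Nm Nn; rewrite -(subrK (Y N x) (Y m x)) -addrA.
apply: le_lt_trans (nrm_triangle _ _) _; rewrite (nrmB (Y N x)).
by rewrite [ltRHS]splitr ltrD ?hN.
Qed.

Lemma contraction_sqrt : exists S : H -> H,
  positive_operator S /\ S \o S =1 (fun x => x - X x).
Proof.
have [Z cZ] := choice sqrt_iter_cvg.
have Zlin : linear Z.
  move=> a x y; apply: cvs_unique (cZ _) _.
  under eq_fun do rewrite sqrt_iter_linear.
  by apply: cvsD; [apply: cvsZ|].
have Zsym x y : rdot (Z x) y = rdot x (Z y).
  have h : (fun n => rdot (Y n x) y) @ \oo --> rdot x (Z y).
    under eq_fun do rewrite sqrt_iter_sym rdotC.
    by rewrite rdotC; exact: cvs_rdot.
  by rewrite -(cvg_lim _ (cvs_rdot (y := y) (cZ x)))// (cvg_lim _ h).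
have Zle x : nrm (Z x) <= nrm x.
  rewrite -subr_ge0; apply: (@cvg_ge0 _ (fun n => nrm x - nrm (Y n x))) => [n|].
    have [/andP[r0 r1] _] := sqrt_iter_norm_bounds n.
    by rewrite subr_ge0 (le_trans (nrm_sqrt_iter _ _))// ler_piMl ?nrm_ge0.
  by apply: cvgB; [exact: cvg_cst | exact: cvs_nrm].
(* Both factors vary with n; the uniform bound [nrm (Y n v)] <= [nrm v] allows the inner one to be
   replaced by its limit first. *)
have YZ x : cvs (fun n => Y n (Y n x)) (Z (Z x)).
  apply: (@cvs_le _ _ _ _ (fun n => nrm (Y n x - Z x) + nrm (Y n (Z x) - Z (Z x)))).
    move=> n; have [/andP[r0 r1] _] := sqrt_iter_norm_bounds n.
    rewrite -(subrK (Y n (Z x)) (Y n (Y n x))) -addrA.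
    apply: le_trans (nrm_triangle _ _) _; rewrite lerD2r.
    rewrite -[- Y n (Z x)]scaleN1r addrC -sqrt_iter_linear scaleN1r addrC.
    by rewrite (le_trans (nrm_sqrt_iter _ _))// ler_piMl ?nrm_ge0.
  by rewrite -[X in _ --> X]addr0; apply: cvgD; exact: cZ.
have ZE x : Z x = (2^-1 : R)%:C *: (X x + Z (Z x)).
  apply: cvs_unique (_ : cvs (fun n => Y n.+1 x) _).
    by have := cZ x; rewrite /cvs -cvg_shiftS.
  by apply: cvsZ; apply: cvsD; [exact: cvs_cst|].
exists (fun x => x - Z x); split; first split.
- by move=> a x y; rewrite Zlin scalerBr opprD addrACA.
(* Nonnegativity in [R[i]] includes vanishing of the imaginary part: by symmetry of [Z], both of its
   terms equal their own opposites. The real part is Cauchy-Schwarz with [Zle]. *)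
- move=> x; rewrite lecE; apply/andP; split.
    have self0 (c : R) : c = - c -> c = 0 by lra.
    rewrite Im_hdot scalerBr rdotBl -(scalable_linear Zlin).
    rewrite (self0 (rdot ('i%R *: x) x)) ?[in LHS]rdot_il ?(rdotC x)// sub0r opprK.
    apply/eqP/self0; rewrite [in LHS]Zsym rdot_il rdotC.
    by rewrite (scalable_linear Zlin).
  rewrite -/(rdot _ _) rdotBl rdotxx subr_ge0.
  rewrite (le_trans (ler_norm _))// (le_trans (rdot_cauchy_schwarz _ _))//.
  by rewrite expr2 ler_wpM2r ?nrm_ge0.
- move=> x /=; have ZZ : X x + Z (Z x) = Z x + Z x.
    rewrite [in RHS]ZE -scalerDl -rmorphD/=.
    by rewrite (_ : 2^-1 + 2^-1 = 1 :> R) ?rmorph1 ?scale1r//; lra.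
  rewrite (zmod_morphism_linear Zlin) -addrA; congr (x + _).
  by rewrite opprB addrCA -opprD -ZZ opprD addrCA subrr addr0.
Qed.

End contraction_sqrt.

(** * Defect operators and the factorization isometry *)

Section defect.
Context {R : realType} {H : hilbertType R}.

(** Complex polarization: the imaginary part of the quadratic form vanishes at x + y, and replacing
    x by i x turns the resulting relation into symmetry. *)
Lemma positive_operator_sym (P : H -> H) : positive_operator P ->
  forall x y, rdot (P x) y = rdot x (P y).
Proof.
move=> [Plin Ppos].
have PD u v : P (u + v) = P u + P v.
  by rewrite -[u]scale1r Plin !scale1r.
have P0 z : rdot ('i%R *: P z) z = 0.
  by apply: oppr_inj; rewrite -Im_hdot oppr0; exact/ger0_Im/Ppos.
have pol x y : rdot ('i%R *: P x) y + rdot ('i%R *: P y) x = 0.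
  have := P0 (x + y); rewrite PD scalerDr rdotDl !rdotDr !P0; lra.
move=> x y; have := pol ('i%R *: x) y.
rewrite (scalable_linear Plin) scalerA -expr2 sqrCi scaleN1r rdotNl rdotii.
by rewrite (rdotC (P y)); lra.
Qed.

Variable A : {linear H -> H}.
Hypothesis Acontr : contractive A.

Local Notation D := (defect_operator A).

(** A*A is a symmetric contraction, so the iteration provides a positive root and [get] returns
    one. *)
Lemma defect_operatorP :
  positive_operator D /\ D \o D =1 (fun x => x - adjoint A (A x)).
Proof.
have := @contraction_sqrt R H (fun x => adjoint A (A x)); rewrite /defect_operator.
case=> [a x y|x y|x|S hS].
- by rewrite linearP (adjoint_linear Acontr).
- by rewrite rdotC -!rdot_adjoint// rdotC.
- by rewrite (le_trans (nrm_adjoint _ _))// contractive_nrm.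
exact: (@getPex _ [set S : H -> H | _] (ex_intro _ S hS)).
Qed.

Lemma defect_operator_linear : linear D.
Proof. by have [[]] := defect_operatorP. Qed.

Lemma defect_operatorB x y : D (x - y) = D x - D y.
Proof. exact: (zmod_morphism_linear defect_operator_linear). Qed.

Lemma nrm_defect x : nrm (D x) ^+ 2 = nrm x ^+ 2 - nrm (A x) ^+ 2.
Proof.
have [Dpos DD] := defect_operatorP.
rewrite -rdotxx positive_operator_sym// -[D (D x)]/((D \o D) x) DD.
by rewrite rdotBr -rdot_adjoint// !rdotxx.
Qed.

Lemma closureP (S : set H) x :
  closure S x <-> exists u, (forall n, S (u n)) /\ cvs u x.
Proof.
split=> [Sx|[u [Su cu]] B /nbhs_ballP[e /= e0 eB]].
  have /choice[u hu] (n : nat) : exists y, S y /\ nrm (y - x) <= n.+1%:R^-1.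
    have [|y [Sy yx]] := Sx (ball x (n.+1%:R^-1 : R)%:C).
      by apply: nbhsx_ballx; rewrite ltcR invr_gt0.
    exists y; split => //; move: yx; rewrite -ball_normE/= normE ltcR nrmB.
    exact: ltW.
  exists u; split=> [n|]; first by have [] := hu n.
  apply: (@cvs_le _ _ _ _ (fun n => n.+1%:R^-1)) => [n|]; first by have [] := hu n.
  exact: cvg_harmonic.
have e0' : 0 < complex.Re e by move: e0; rewrite ltcE => /andP[].
have [N _ hN] := cvgr_lt _ cu _ e0'.
exists (u N); split => //; apply: eB; rewrite -ball_normE/= normE nrmB.
rewrite -(RRe_real (gtr0_real e0)) ltcR; exact: (hN N (leqnn N)).
Qed.

Lemma defect_spaceD (a : R[i]) x y :
  defect_space A x -> defect_space A y -> defect_space A (a *: x + y).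
Proof.
move=> /closureP[u [uD cu]] /closureP[v [vD cv]]; apply/closureP.
exists (fun n => a *: u n + v n); split; last by apply: cvsD => //; exact: cvsZ.
move=> n; have [[h _ <-] [k _ <-]] := (uD n, vD n).
by exists (a *: h + k) => //; rewrite defect_operator_linear.
Qed.

Lemma defect_space0 : defect_space A 0.
Proof.
by apply: subset_closure; exists 0 => //; rewrite -(subrr 0) defect_operatorB !subrr.
Qed.

End defect.

Section factorization.
Context {R : realType} {H : hilbertType R}.
Variables A B : {linear H -> H}.
Hypotheses (Acontr : contractive A) (Bcontr : contractive B).

Lemma contractive_comp : contractive (A \o B).
Proof. by move=> x; apply: le_trans (Acontr _) (Bcontr _). Qed.

Let DT := defect_operator (A \o B).
Let DA := defect_operator A.
Let DB := defect_operator B.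
Let VT := defect_space (A \o B).

Let DTB x y : DT (x - y) = DT x - DT y.
Proof. exact: (defect_operatorB contractive_comp). Qed.

(** The two occurrences of ||B x||^2 cancel. *)
Lemma nrm_defect_comp x : nrm (DT x) ^+ 2 = nrm (DA (B x)) ^+ 2 + nrm (DB x) ^+ 2.
Proof.
rewrite (nrm_defect contractive_comp) (nrm_defect Acontr) (nrm_defect Bcontr)/=.
ring.
Qed.

(* The closure of the graph of [D_(AB) h |-> (D_A B h, D_B h)]. *)
Definition factorization_graph x (p : H * H) := exists h : nat -> H,
  [/\ cvs (fun n => DT (h n)) x, cvs (fun n => DA (B (h n))) p.1
    & cvs (fun n => DB (h n)) p.2].

Local Notation G := factorization_graph.

Lemma factorization_graph_norm x p :
  G x p -> nrm p.1 ^+ 2 + nrm p.2 ^+ 2 = nrm x ^+ 2.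
Proof.
move=> [h [cT cA cB]].
have sqr_cvg u (y : H) : cvs u y -> (fun n => nrm (u n) ^+ 2) @ \oo --> nrm y ^+ 2.
  by move=> /cvs_nrm c; rewrite expr2; under eq_fun do rewrite expr2; exact: cvgM.
rewrite -(cvg_lim _ (sqr_cvg _ _ cT))//; apply/esym/cvg_lim => //.
under eq_fun do rewrite nrm_defect_comp.
by apply: cvgD; exact: sqr_cvg.
Qed.

Lemma factorization_graph_linear (a : R[i]) x y p q :
  G x p -> G y q -> G (a *: x + y) (a *: p + q).
Proof.
move=> [h [cT cA cB]] [k [cT' cA' cB']]; exists (fun n => a *: h n + k n).
split.
- under eq_fun do rewrite /DT (defect_operator_linear contractive_comp).
  by apply: cvsD => //; exact: cvsZ.
- under eq_fun do rewrite linearP /DA (defect_operator_linear Acontr).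
  by apply: cvsD => //; exact: cvsZ.
- under eq_fun do rewrite /DB (defect_operator_linear Bcontr).
  by apply: cvsD => //; exact: cvsZ.
Qed.

(** The difference of two points over the same x lies over 0, hence has norm 0. *)
Lemma factorization_graph_unique x p q : G x p -> G x q -> p = q.
Proof.
move=> xp xq; have := factorization_graph_norm (factorization_graph_linear (-1) xq xp).
rewrite !scaleN1r addNr nrm0 expr0n/= => h.
have s0 : nrm (- q.1 + p.1) = 0 /\ nrm (- q.2 + p.2) = 0.
  by split; apply/eqP; rewrite -sqrf_eq0;
    have := sqr_ge0 (nrm (- q.1 + p.1)); have := sqr_ge0 (nrm (- q.2 + p.2)); lra.
case: s0 h => + + _; case: p q {xp xq} => [p1 p2] [q1 q2] /=.
by rewrite ![- _ + _]addrC => /nrm_eq0/subr0_eq -> /nrm_eq0/subr0_eq ->.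
Qed.

(** Take h_n with D_T h_n tending to x. The h_n may diverge, but D_A B and D_B are dominated in norm
    by D_T, so both image sequences are Cauchy. *)
Lemma factorization_graph_total x : VT x -> exists p, G x p.
Proof.
move=> /closureP[u [uD cu]].
have /choice[h hu] n : exists y, DT y = u n by have [y _ <-] := uD n; exists y.
have conv (F : H -> H) : (forall x y, F (x - y) = F x - F y) ->
    (forall x, nrm (F x) <= nrm (DT x)) -> exists l, cvs (fun n => F (h n)) l.
  move=> FB Fle; apply: hilbert_complete => e e0.
  have [N _ hN] := cvgr_lt _ cu _ (divr_gt0 e0 (ltr0n R 2)).
  exists N => m n Nm Nn; rewrite -FB (le_lt_trans (Fle _))// DTB !hu.
  rewrite -(subrK x (u m)) -addrA (le_lt_trans (nrm_triangle _ _))//.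
  by rewrite (nrmB x) [ltRHS]splitr ltrD ?hN.
have le_sqr y z w : nrm y ^+ 2 = nrm z ^+ 2 + nrm w ^+ 2 -> nrm (z : H) <= nrm (y : H).
  move=> e; rewrite -(@ler_pXn2r _ 2) ?nnegrE ?nrm_ge0// e.
  by rewrite lerDl sqr_ge0.
have [||p1 c1] := conv (DA \o B).
- by move=> y z; rewrite /= linearB /DA defect_operatorB.
- by move=> y; apply: le_sqr (nrm_defect_comp y).
have [||p2 c2] := conv DB.
- by move=> y z; rewrite /DB defect_operatorB.
- by move=> y; apply: le_sqr (_ : _ = _ + nrm (DA (B y)) ^+ 2); rewrite nrm_defect_comp addrC.
exists (p1, p2), h; split => //.
by under eq_fun do rewrite hu.
Qed.

Lemma factorization_isometry_exists : exists Z, is_factorization_isometry A B Z.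
Proof.
(* On [VT] the graph is total and functional, so [xget] reads off its value; the default 0 is taken
   only outside [VT]. *)
have GZ x : VT x -> G x (xget 0 (G x)).
  by move=> /factorization_graph_total; exact: (@xgetPex _ 0 (G x)).
exists (fun x => xget 0 (G x)); split.
- move=> x /GZ; case: (xget _ _) => p1 p2 [h [_ c1 c2]].
  by split; apply/closureP; eexists; split; try eassumption; move=> n; eexists.
- move=> a x y xT yT; apply: (@factorization_graph_unique (a *: x + y)).
    exact/GZ/(defect_spaceD contractive_comp).
  by apply: factorization_graph_linear; exact: GZ.
- move=> x xT; rewrite !normE -!rmorphXn -rmorphD/=.
  by rewrite (factorization_graph_norm (GZ _ xT)).
- move=> h; apply: (@factorization_graph_unique (DT h)).
    by apply/GZ/subset_closure; exists h.
  by exists (fun=> h); split; exact: cvs_cst.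
Qed.

Lemma factorization_isometry_inj Z : is_factorization_isometry A B Z ->
  forall x y, VT x -> VT y -> Z x = Z y -> x = y.
Proof.
move=> [_ Zlin Znorm _] x y xT yT Zxy.
have := Znorm _ (defect_spaceD contractive_comp (a := -1) yT xT).
rewrite Zlin// Zxy scaleN1r addNr normr0 expr0n/= addr0 => /esym/eqP.
by rewrite sqrf_eq0 normr_eq0 scaleN1r addrC subr_eq0 => /eqP.
Qed.

End factorization.

(** * Injective endomorphisms of finite-dimensional subspaces are onto *)

Section finite_dimension.
Context {R : realType} {H : hilbertType R}.
Variables (V : set H) (f : H -> H).
Hypothesis V0 : V 0.
Hypothesis VD : forall (a : R[i]) x y, V x -> V y -> V (a *: x + y).
Hypothesis fV : forall x, V x -> V (f x).
Hypothesis flin : forall (a : R[i]) x y, V x -> V y -> f (a *: x + y) = a *: f x + f y.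
Hypothesis finj : forall x, V x -> f x = 0 -> x = 0.

Let f0 : f 0 = 0.
Proof.
by have := flin 1 V0 V0; rewrite !scale1r addr0 => /eqP; rewrite -subr_eq0 opprD
  addrA subrr sub0r oppr_eq0 => /eqP.
Qed.

Let iterV y i : V y -> V (iter i f y).
Proof. by move=> Vy; elim: i => //= i; exact: fV. Qed.

Let lincomb d (k : nat -> R[i]) y : V y ->
  V (\sum_(i < d) k i *: iter i f y) /\
  f (\sum_(i < d) k i *: iter i f y) = \sum_(i < d) k i *: iter i.+1 f y.
Proof.
move=> Vy; elim: d => [|d [IH1 IH2]]; first by rewrite !big_ord0.
rewrite !big_ord_recr/= addrC; split; first by apply: VD => //; exact: iterV.
by rewrite flin ?IH2 1?addrC//; exact: iterV.
Qed.

(* A nontrivial relation between the iterates [y, f y, f (f y), ...] can be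
   divided by [f] until its coefficient of [y] is nonzero. *)
Let relation_onto d (k : nat -> R[i]) y : V y ->
  (exists2 i, (i < d)%N & k i != 0) ->
  \sum_(i < d) k i *: iter i f y = 0 -> exists2 x, V x & f x = y.
Proof.
move=> Vy; elim: d k => [k [//]|d IH k [i id ki]].
rewrite big_ord_recl/=; under eq_bigr do rewrite /bump/= add1n.
have [VS fS] := lincomb d (fun i => k i.+1) Vy.
rewrite -fS; have [k0|k0 e] := eqVneq (k 0%N) 0.
  rewrite k0 scale0r add0r => /(finj VS); apply: (IH (fun i => k i.+1)).
  by case: i id ki => [|i] id ki; [rewrite k0 eqxx in ki | exists i].
(* The relation reads k_0 y + f s = 0, with s the sum below and k_0 invertible. *)
exists (- (k 0%N)^-1 *: \sum_(i < d) k i.+1 *: iter i f y).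
  by rewrite -[_ *: _]addr0; exact: VD.
rewrite -[_ *: _]addr0 flin// f0 addr0 scaleNr -scalerN.
by rewrite -(addr0_eq e) opprK scalerA mulVf// scale1r.
Qed.

(** The n+1 iterates of y, expanded in n spanning vectors, form a matrix with more rows than
    columns; a nonzero vector of its left kernel is a nontrivial relation among them. *)
Lemma finite_dimensional_onto : finite_dimensional V ->
  forall y, V y -> exists2 x, V x & f x = y.
Proof.
move=> [n [e [_ span]]] y Vy.
have /choice[c hc] (i : nat) : exists c : 'I_n -> R[i], iter i f y = \sum_(j < n) c j *: e j.
  exact/span/iterV.
pose M : 'M[R[i]]_(n.+1, n) := \matrix_(i, j) c i j.
have : kermx M != 0.
  rewrite -mxrank_eq0 mxrank_ker -lt0n subn_gt0.
  by rewrite ltnS rank_leq_col.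
move=> /rowV0Pn[v /sub_kermxP vM v0].
have /rV0Pn[i0 vi0] := v0.
apply: (@relation_onto n.+1 (fun i => v 0 (inord i)) _ Vy).
  by exists i0 => //; rewrite inord_val.
under eq_bigr do rewrite inord_val hc scaler_sumr.
rewrite exchange_big/= big1// => j _.
under eq_bigr do rewrite scalerA.
rewrite -scaler_suml (_ : \sum_i _ = 0) ?scale0r//.
have /matrixP/(_ 0 j) := vM; rewrite !mxE => {2}<-.
by apply: eq_bigr => i _; rewrite mxE.
Qed.

End finite_dimension.

Lemma regular_factorization_comm (R : realType) (H : hilbertType R)
    (A B : {linear H -> H}) :
  contractive A -> contractive B -> A \o B =1 B \o A ->
  finite_dimensional (defect_space (A \o B)) ->
  regular_factorization A B -> regular_factorization B A.
Proof.
move=> Ac Bc /funext AB fd [Z Ziso Zonto].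
have [Z' Z'iso] := factorization_isometry_exists Bc Ac.
have Tc := contractive_comp Ac Bc.
have Zinj := factorization_isometry_inj Ac Bc Ziso.
have Z'inj := factorization_isometry_inj Bc Ac Z'iso.
have [ZV Zlin _ _] := Ziso; have [Z'V Z'lin _ _] := Z'iso.
rewrite -AB in Z'inj Z'V Z'lin *.
set V := defect_space (A \o B) in fd Zonto Zinj Z'inj ZV Zlin Z'V Z'lin *.
have V0 : V 0 by exact: defect_space0 Tc.
have VD : forall a x y, V x -> V y -> V (a *: x + y) by exact: defect_spaceD Tc.
have Z'0 : Z' 0 = 0.
  by have := Z'lin (-1) _ _ V0 V0; rewrite scaler0 addr0 scaleN1r addNr.
(* [f] is Z^-1 after the flip of Z', which makes sense because [Z] is onto; off [V] its value is
   arbitrary. *)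
have /choice[f hf] x : exists y, V x -> V y /\ Z y = ((Z' x).2, (Z' x).1).
  have [Vx|nVx] := pselect (V x); last by exists 0.
  have [v1 v2] := Z'V _ Vx.
  have : (Z @` V) ((Z' x).2, (Z' x).1) by rewrite Zonto.
  by move=> [y Vy <-]; exists y.
have fonto := @finite_dimensional_onto _ _ V f V0 VD _ _ _ fd.
exists Z' => //; rewrite -AB -/V; apply/seteqP; split=> [_ [x Vx <-]|]; first exact: Z'V.
move=> [q p] [/= Vq Vp].
(* The flipped target is Z x; if f y = x then Z (f y) = (p, q), which says Z' y = (q, p). *)
have : (Z @` V) (p, q) by rewrite Zonto.
move=> [x Vx Zx]; have [|||y Vy fy] := fonto _ _ _ x Vx.
- by move=> y Vy; have [] := hf y Vy.
- move=> a y z Vy Vz.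
  have [Vfy Zfy] := hf _ Vy; have [Vfz Zfz] := hf _ Vz.
  have [Vf Zf] := hf _ (VD a _ _ Vy Vz).
  apply: Zinj => //; first exact: VD.
  by rewrite Zf Zlin// Zfy Zfz Z'lin.
- move=> y Vy fy; have [_] := hf _ Vy.
  have Z0 : Z 0 = 0.
    by have := Zlin (-1) _ _ V0 V0; rewrite scaler0 addr0 scaleN1r addNr.
  rewrite fy Z0 => -[e2 e1]; apply: Z'inj => //.
  by rewrite Z'0 [Z' y]surjective_pairing -e1 -e2.
exists y => //; have [_] := hf _ Vy; rewrite fy Zx => -[-> ->].
by rewrite -surjective_pairing.
Qed.

(** * The Hilbert space of square-summable sequences *)

Section l2.
Variable R : realType.
Implicit Types (u v : nat -> R[i]^o).

(** The real part of z times the conjugate of w, that is, the dot product of the plane. *)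
Definition re_dot (z w : R[i]) : R :=
  complex.Re z * complex.Re w + complex.Im z * complex.Im w.

Definition square_summable : {pred nat -> R[i]^o} := fun u =>
  `[< exists M, forall n, \sum_(k < n) re_dot (u k) (u k) <= M >].

Lemma re_dotxx_ge0 z : 0 <= re_dot z z.
Proof. by rewrite addr_ge0// -expr2 sqr_ge0. Qed.

Lemma re_dot_le z w : `|re_dot z w| <= 2^-1 * (re_dot z z + re_dot w w).
Proof.
rewrite /re_dot; case: z w => [a b] [c d] /=; rewrite ler_norml.
have := sqr_ge0 (a - c); have := sqr_ge0 (a + c).
have := sqr_ge0 (b - d); have := sqr_ge0 (b + d).
by rewrite !expr2 => *; apply/andP; split; lra.
Qed.

Lemma re_dotDl z w x : re_dot (z + w) x = re_dot z x + re_dot w x.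
Proof. by rewrite /re_dot; case: z w x => [? ?] [? ?] [? ?] /=; ring. Qed.

Lemma re_dotZ a z : re_dot (a * z) (a * z) = re_dot a a * re_dot z z.
Proof. by rewrite /re_dot; case: a z => [? ?] [? ?] /=; ring. Qed.

Lemma re_dotC z w : re_dot z w = re_dot w z.
Proof. by rewrite /re_dot mulrC (mulrC (complex.Im z)). Qed.

Lemma square_summable_closed : submod_closed square_summable.
Proof.
split.
  apply/asboolP; exists 0 => n; rewrite big1// => i _.
  by rewrite /re_dot /= mulr0 addr0.
move=> a u v /asboolP[M hM] /asboolP[N hN]; apply/asboolP.
(* From |z + w|^2 <= 2 |z|^2 + 2 |w|^2 in each coordinate. *)
exists (2 * (re_dot a a * M) + 2 * N) => n.
apply: (@le_trans _ _ (2 * (re_dot a a * \sum_(k < n) re_dot (u k) (u k)) +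
    2 * \sum_(k < n) re_dot (v k) (v k))); last first.
  by rewrite lerD// ler_pM2l// ler_wpM2l ?re_dotxx_ge0.
rewrite !mulr_sumr -big_split; apply: ler_sum => k _ /=.
rewrite -[(a *: u + v) k]/(a * u k + v k) -re_dotZ.
move: (a * u k) (v k) => z w.
have := re_dot_le z w; rewrite ler_norml => /andP[_].
by rewrite !re_dotDl !(re_dotC _ (z + w)) !re_dotDl (re_dotC w z); lra.
Qed.

HB.instance Definition _ :=
  GRing.isSubmodClosed.Build R[i] (nat -> R[i]^o) square_summable square_summable_closed.

Record l2 := L2 { l2_seq :> nat -> R[i]^o; _ : square_summable l2_seq }.

HB.instance Definition _ := [isSub for l2_seq].
HB.instance Definition _ := gen_eqMixin l2.
HB.instance Definition _ := gen_choiceMixin l2.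
HB.instance Definition _ := [SubChoice_isSubLmodule of l2 by <:].

Implicit Types x y z : l2.

Lemma l2D x y k : (x + y) k = x k + y k.
Proof. by []. Qed.

Lemma l2Z (a : R[i]) x k : (a *: x) k = a * x k.
Proof. by []. Qed.

Lemma l2P x : exists M, forall n, \sum_(k < n) re_dot (x k) (x k) <= M.
Proof. by case: x => u /= /asboolP. Qed.

(** Only the real part of the future inner product, so that the theory of real series applies;
    [l2_dot] restores the imaginary part. *)
Definition l2_rdot x y : R := limn (series (fun k => re_dot (x k) (y k))).

Lemma l2_rdot_cvg x y : cvgn (series (fun k => re_dot (x k) (y k))).
Proof.
apply: normed_cvg; apply: nondecreasing_is_cvgn.
  by apply: nondecreasing_series => k _ _; exact: normr_ge0.
have [M hM] := l2P x; have [N hN] := l2P y.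
exists (2^-1 * (M + N)) => _ [n _ <-].
rewrite -[leLHS]/(\sum_(0 <= k < n) `|re_dot (x k) (y k)|) big_mkord.
apply: (@le_trans _ _ (\sum_(k < n) 2^-1 * (re_dot (x k) (x k) + re_dot (y k) (y k)))).
  by apply: ler_sum => k _; exact: re_dot_le.
by rewrite -mulr_sumr big_split/= ler_pM2l ?invr_gt0//; exact: lerD (hM n) (hN n).
Qed.

Lemma l2_rdotC x y : l2_rdot x y = l2_rdot y x.
Proof. by congr (limn (series _)); apply/funext => k; rewrite re_dotC. Qed.

Lemma l2_rdotDl x y z : l2_rdot (x + y) z = l2_rdot x z + l2_rdot y z.
Proof.
rewrite /l2_rdot -lim_seriesD; [|exact: l2_rdot_cvg..].
by congr (limn (series _)); apply/funext => k; rewrite l2D re_dotDl.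
Qed.

Lemma l2_rdotZl (t : R) x y : l2_rdot (t%:C *: x) y = t * l2_rdot x y.
Proof.
rewrite /l2_rdot -[RHS]lim_seriesZ; last exact: l2_rdot_cvg.
congr (limn (series _)); apply/funext => k; rewrite l2Z /re_dot.
by rewrite fctE; case: (x k) (y k) => [? ?] [? ?] /=; rewrite /GRing.scale/=; ring.
Qed.

Lemma l2_rdotii x y : l2_rdot ('i%R *: x) ('i%R *: y) = l2_rdot x y.
Proof.
congr (limn (series _)); apply/funext => k; rewrite !l2Z -complexiE /re_dot.
by case: (x k) (y k) => [? ?] [? ?] /=; ring.
Qed.

Lemma l2_rdotZZ (a : R[i]) x : l2_rdot (a *: x) (a *: x) = re_dot a a * l2_rdot x x.
Proof.
rewrite /l2_rdot -[RHS]lim_seriesZ; last exact: l2_rdot_cvg.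
by congr (limn (series _)); apply/funext => k; rewrite l2Z re_dotZ.
Qed.

Lemma l2_rdot_ge_sum x n : \sum_(k < n) re_dot (x k) (x k) <= l2_rdot x x.
Proof.
have := @nondecreasing_cvgn_le _ (series (fun k => re_dot (x k) (x k))) _ _ n.
rewrite /series/= big_mkord; apply; last exact: l2_rdot_cvg.
by apply: nondecreasing_series => k _ _; exact: re_dotxx_ge0.
Qed.

Lemma l2_rdot_le x M :
  (forall n, \sum_(k < n) re_dot (x k) (x k) <= M) -> l2_rdot x x <= M.
Proof.
move=> h; apply: limr_le; first exact: l2_rdot_cvg.
by apply: nearW => n; rewrite /series/= big_mkord.
Qed.

Lemma l2_rdotxx_ge0 x : 0 <= l2_rdot x x.
Proof. by have := l2_rdot_ge_sum x 0; rewrite big_ord0. Qed.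

Lemma re_dot_le_l2 x k : re_dot (x k) (x k) <= l2_rdot x x.
Proof.
apply: le_trans (l2_rdot_ge_sum x k.+1); rewrite big_ord_recr/= lerDr.
by apply: sumr_ge0 => i _; exact: re_dotxx_ge0.
Qed.

Lemma l2_rdot_eq0 x : l2_rdot x x = 0 -> x = 0.
Proof.
move=> x0; apply/val_inj/funext => k /=.
have := re_dot_le_l2 x k; rewrite x0 /re_dot.
by case: (l2_seq x k) => a b /=; rewrite -!expr2 => h; congr Complex;
  apply/eqP; rewrite -sqrf_eq0; have := sqr_ge0 a; have := sqr_ge0 b; lra.
Qed.

Definition l2_norm x : R[i] := (Num.sqrt (l2_rdot x x))%:C.

Lemma l2_normD x y : l2_norm (x + y) <= l2_norm x + l2_norm y.
Proof.
rewrite /l2_norm -rmorphD lecR.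
exact: form_triangle l2_rdotC l2_rdotDl l2_rdotZl l2_rdotxx_ge0 _ _.
Qed.

Lemma l2_normZ (a : R[i]) x : l2_norm (a *: x) = `|a| * l2_norm x.
Proof.
by rewrite /l2_norm l2_rdotZZ normc_def -rmorphM/= -sqrtrM ?addr_ge0 ?sqr_ge0.
Qed.

Lemma l2_norm_eq0 x : l2_norm x = 0 -> x = 0.
Proof.
move=> /complexI/eqP; rewrite sqrtr_eq0 => h; apply/l2_rdot_eq0/eqP.
by rewrite eq_le h l2_rdotxx_ge0.
Qed.

HB.instance Definition _ :=
  Lmodule_isNormed.Build R[i] l2 l2_normD l2_normZ l2_norm_eq0.

End l2.

(** * Completeness and inner product of l^2; the unilateral shift *)

Section l2_hilbert.
Variable R : realType.
Local Notation l2 := (l2 R).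
Implicit Types x y z : l2.

Lemma l2_normE x : `|x| = (Num.sqrt (l2_rdot x x))%:C.
Proof. by []. Qed.

Lemma l2_norm_le x (e : R) :
  0 <= e -> (`|x| <= e%:C) = (l2_rdot x x <= e ^+ 2).
Proof.
move=> e0; rewrite l2_normE lecR -[in RHS](sqr_sqrtr (l2_rdotxx_ge0 x)).
by rewrite ler_pXn2r ?nnegrE ?sqrtr_ge0.
Qed.

(** Coordinates converge, their real and imaginary parts being Cauchy in R. Norm convergence to the
    coordinatewise limit is a Fatou argument: bounds on finite partial sums pass to the limit along
    [F], uniformly in the number of terms. *)
Lemma l2_complete (F : set_system l2) : ProperFilter F -> cauchy F -> cvg F.
Proof.
move=> FF /cauchyP cF.
have small (e : R) : 0 < e -> exists2 A, F A &
    forall x y, A x -> A y -> l2_rdot (x - y) (x - y) <= e ^+ 2.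
  move=> e0; have [|x Fx] := cF (e / 2)%:C; first by rewrite ltcR divr_gt0.
  exists (ball x (e / 2)%:C) => // y z xy xz; rewrite -(l2_norm_le _ (ltW e0)).
  rewrite -(subrK x y) -addrA (le_trans (ler_normD _ _))// (splitr e) rmorphD/=.
  rewrite distrC lerD//; first by move: xy; rewrite -ball_normE => /ltW.
  by move: xz; rewrite -ball_normE => /ltW.
have coord (p : R[i] -> R) k : (forall z w : R[i], p (z - w) = p z - p w) ->
    (forall z : R[i], p z ^+ 2 <= re_dot z z) ->
    exists a : R, (fun x : l2 => p (x k)) @ F --> a.
  move=> pB ple; suff : cvg ((fun x : l2 => p (x k)) @ F) by move=> /cvg_ex[a ca]; exists a.
  apply: cauchy_cvg; apply: cauchy_exP => e e0.
  have [A FA hA] := small (e / 2) (divr_gt0 e0 (ltr0n _ 2)).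
  have [x Ax] := filter_ex FA; exists (p (x k)).
  change (F ((fun y : l2 => p (y k)) @^-1` ball (p (x k)) e)).
  apply: filterS FA => y Ay; rewrite /preimage/=; rewrite -ball_normE/= -pB.
  apply: (@le_lt_trans _ _ (e / 2)); last by rewrite ltr_pdivrMr// mulr_natr mulr2n ltrDl.
  rewrite -(@ler_pXn2r _ 2) ?nnegrE ?(ltW (divr_gt0 e0 (ltr0n _ 2)))//.
  rewrite real_normK ?num_real//.
  apply: le_trans (hA _ _ Ax Ay); apply: le_trans (re_dot_le_l2 (x - y) k).
  exact: ple.
have /choice[a ca] k : exists a : R, (fun x : l2 => complex.Re (x k)) @ F --> a.
  apply: coord => [z w|z]; first by rewrite Re_add Re_opp.
  by rewrite /re_dot -!expr2 lerDl sqr_ge0.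
have /choice[b cb] k : exists b : R, (fun x : l2 => complex.Im (x k)) @ F --> b.
  apply: coord => [[? ?] [? ?]//|z].
  by rewrite /re_dot -!expr2 lerDr sqr_ge0.
pose l : nat -> R[i]^o := fun k => a k +i* b k.
have lim_sum x n : (fun y : l2 => \sum_(k < n) re_dot ((x - y) k) ((x - y) k)) @ F
    --> \sum_(k < n) re_dot (x k - l k) (x k - l k).
  elim: n => [|n IH].
    by under eq_fun do rewrite big_ord0; rewrite big_ord0; exact: cvg_cst.
  under eq_fun do rewrite big_ord_recr/=; rewrite big_ord_recr/=.
  apply: cvgD => //; rewrite /re_dot.
  have cRe : (fun y : l2 => complex.Re ((x - y) n)) @ F --> complex.Re (x n - l n).
    rewrite Re_add Re_opp; under eq_fun do rewrite Re_add Re_opp.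
    by apply: cvgB; [exact: cvg_cst | exact: ca].
  have cIm : (fun y : l2 => complex.Im ((x - y) n)) @ F --> complex.Im (x n - l n).
    have ImB (z w : R[i]) : complex.Im (z - w) = complex.Im z - complex.Im w.
      by case: z w => [? ?] [].
    rewrite ImB; under eq_fun do rewrite ImB.
    by apply: cvgB; [exact: cvg_cst | exact: cb].
  by apply: cvgD; exact: cvgM.
have sum_le e A x n : F A ->
    (forall x y, A x -> A y -> l2_rdot (x - y) (x - y) <= e ^+ 2) -> A x ->
    \sum_(k < n) re_dot (x k - l k) (x k - l k) <= e ^+ 2.
  move=> FA hA Ax; rewrite -(cvg_lim _ (lim_sum x n))//; apply: limr_le.
    by apply/cvg_ex; eexists; exact: lim_sum.
  apply: filterS FA => y Ay; apply: le_trans (l2_rdot_ge_sum _ _) (hA _ _ Ax Ay).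
have lP : l \in @square_summable R.
  have [A FA hA] := small 1 ltr01; have [x Ax] := filter_ex FA.
  (* l = x - (x - l), where x is in l^2 and x - l has partial sums bounded by 1. *)
  rewrite -[l](subKr (x : nat -> R[i]^o)); apply: rpredB; first by case: (x).
  by apply/asboolP; exists (1 ^+ 2) => n; exact: (sum_le _ _ _ n FA hA Ax).
apply/cvg_ex; exists (L2 lP); apply/cvgrPdist_le => e e0.
have eE : e = (complex.Re e)%:C by rewrite RRe_real// gtr0_real.
have e0' : 0 < complex.Re e by rewrite -ltcR -eE.
have [A FA hA] := small _ e0'.
apply: filterS (FA) => x Ax; rewrite distrC eE (l2_norm_le _ (ltW e0')).
by apply: l2_rdot_le => n; exact: (sum_le _ _ _ n FA hA Ax).
Qed.

HB.instance Definition _ := Uniform_isComplete.Build l2 l2_complete.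

(** Conjugate linearity in y makes (x, i y) equal to -i (x, y), whose real part is the imaginary
    part of (x, y). *)
Definition l2_dot x y : R[i] := l2_rdot x y +i* l2_rdot x ('i%R *: y).

Lemma l2_rdot_il x y : l2_rdot ('i%R *: x) y = - l2_rdot x ('i%R *: y).
Proof.
rewrite -l2_rdotii scalerA -expr2 sqrCi.
by rewrite -[-1](rmorphN1 (real_complex R)) l2_rdotZl mulN1r.
Qed.

Lemma l2_dot_conj x y : l2_dot x y = (-1) ^+ false * Num.conj (l2_dot y x).
Proof.
rewrite expr0 mul1r; apply/eqP; rewrite eq_complex /= l2_rdotC eqxx/=.
by rewrite -l2_rdot_il l2_rdotC.
Qed.

Lemma l2_dotDl x y z : l2_dot (x + y) z = l2_dot x z + l2_dot y z.
Proof. by rewrite /l2_dot !l2_rdotDl. Qed.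

Lemma l2_dotZl (a : R[i]) x y : l2_dot (a *: x) y = a * l2_dot x y.
Proof.
have rZ z : l2_rdot (a *: x) z =
    complex.Re a * l2_rdot x z - complex.Im a * l2_rdot x ('i%R *: z).
  rewrite [a in LHS]complexE mulrC scalerDl -scalerA l2_rdotDl !l2_rdotZl.
  by rewrite complexiE l2_rdot_il mulrN.
rewrite /l2_dot !rZ scalerA -expr2 sqrCi -[-1](rmorphN1 (real_complex R)).
rewrite ![l2_rdot x (_%:C *: _)]l2_rdotC l2_rdotZl (l2_rdotC y).
apply/eqP; rewrite eq_complex /=; case: a {rZ} => a b /=.
by apply/andP; split; apply/eqP; ring.
Qed.

Lemma l2_dotBl y : zmod_morphism (l2_dot^~ y).
Proof. by move=> x z; rewrite l2_dotDl -scaleN1r l2_dotZl mulN1r. Qed.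

Lemma l2_dotBr x : zmod_morphism (l2_dot x).
Proof.
by move=> y z; rewrite !(l2_dot_conj x) l2_dotBl rmorphB !expr0 !mul1r.
Qed.

Lemma l2_dotZr x : scalable_for (Num.conj \; *%R) (l2_dot x).
Proof.
by move=> a y; rewrite !(l2_dot_conj x) l2_dotZl rmorphM !expr0 !mul1r.
Qed.

Lemma l2_dot_norm x : l2_dot x x = `|x| ^+ 2.
Proof.
rewrite l2_normE -rmorphXn/= sqr_sqrtr ?l2_rdotxx_ge0//.
apply/eqP; rewrite eq_complex /= eqxx/=; apply/eqP.
have := l2_rdot_il x x; rewrite l2_rdotC; lra.
Qed.

Lemma l2_dot_gt0 x : x != 0 -> 0 < l2_dot x x.
Proof. by move=> x0; rewrite l2_dot_norm exprn_gt0// normr_gt0. Qed.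

HB.instance Definition _ := isBilinear.Build R[i] l2 l2 R[i]
  *%R (@Num.conj R[i] \; *%R) l2_dot l2_dotBl l2_dotBr
  (fun y a x => l2_dotZl a x y) l2_dotZr.
HB.instance Definition _ := isHermitianSesquilinear.Build R[i] l2 false
  (@Num.conj R[i]) l2_dot l2_dot_conj.
HB.instance Definition _ := isDotProduct.Build R[i] l2 l2_dot l2_dot_gt0.

HB.instance Definition _ :=
  @CompleteNormedModule_isHilbert.Build R l2 l2_dot l2_dot_norm.

Definition shift_seq (u : nat -> R[i]^o) k : R[i]^o := if k is k.+1 then u k else 0.

Lemma shift_sum (u : nat -> R[i]^o) n :
  \sum_(k < n.+1) re_dot (shift_seq u k) (shift_seq u k) =
  \sum_(k < n) re_dot (u k) (u k).
Proof. by rewrite big_ord_recl /= [X in X + _](_ : _ = 0) ?add0r// /re_dot/= mul0r addr0. Qed.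

Lemma shift_square_summable x : shift_seq x \in @square_summable R.
Proof.
have [M hM] := l2P x; apply/asboolP; exists M => -[|n].
  by rewrite big_ord0; have := hM 0%N; rewrite big_ord0.
by rewrite shift_sum.
Qed.

Definition shift x : l2 := L2 (shift_square_summable x).

Lemma shift_linear : linear shift.
Proof.
move=> a x y; apply/val_inj/funext => -[|k] //=.
by rewrite -[RHS]/(a * 0 + 0) mulr0 addr0.
Qed.

HB.instance Definition _ := GRing.isLinear.Build R[i] l2 l2 *:%R shift shift_linear.

Lemma shift_isometry x : `|shift x| = `|x|.
Proof.
rewrite !l2_normE; congr (Num.sqrt _)%:C; apply/eqP; rewrite eq_le.
apply/andP; split; apply: l2_rdot_le.
- case=> [|n]; first by rewrite big_ord0 l2_rdotxx_ge0.
  by rewrite shift_sum l2_rdot_ge_sum.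
- by move=> n; rewrite -shift_sum; exact: (l2_rdot_ge_sum (shift x)).
Qed.

Lemma shift_not_onto : exists y, forall x, shift x != y.
Proof.
pose u : nat -> R[i]^o := fun k => if k is 0%N then 1 else 0.
have uP : u \in @square_summable R.
  apply/asboolP; exists 1 => -[|n]; first by rewrite big_ord0 ler01.
  rewrite big_ord_recl big1 => [|k _]; rewrite /re_dot /= ?mul0r ?addr0//.
exists (L2 uP) => x; apply/eqP => /(congr1 (fun z : l2 => z 0%N)) /= /eqP.
by rewrite eq_sym oner_eq0.
Qed.

End l2_hilbert.

(** * Factorizations of 0 through an isometry *)

Section isometry_zero.
Context {R : realType} {H : hilbertType R}.
Variable S : {linear H -> H}.
Hypothesis Siso : forall x, `|S x| = `|x|.
Let O : {linear H -> H} := \0.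

Lemma isometry_contractive : contractive S.
Proof. by move=> x; rewrite Siso. Qed.

Lemma zero_contractive : contractive O.
Proof. by move=> x; rewrite /= normr0. Qed.

Lemma defect_isometry x : defect_operator S x = 0.
Proof.
apply: nrm_eq0; apply/eqP; rewrite -sqrf_eq0 nrm_defect; last exact: isometry_contractive.
by rewrite /nrm Siso subrr.
Qed.

(** D_0 squares to I - 0 = I, so D_0 is its own inverse; every vector is then a value of D_0, where
    the factorization isometry is explicit. *)
Lemma defect_zeroK x : defect_operator O (defect_operator O x) = x.
Proof.
have [_ /(_ x) /= ->] := defect_operatorP zero_contractive.
by rewrite -(subrr 0) (zmod_morphism_linear (adjoint_linear zero_contractive)) subrr subr0.
Qed.

Lemma defect_space_zero x : defect_space O x.
Proof. by apply: subset_closure; exists (defect_operator O x) => //; rewrite defect_zeroK. Qed.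

Lemma defect_space_isometry x : defect_space S x -> x = 0.
Proof.
move=> /closureP[u [uD cu]]; apply: cvs_unique cu _.
have -> : u = fun=> 0 by apply/funext => n; have [h _ <-] := uD n; exact: defect_isometry.
exact: cvs_cst.
Qed.

Lemma isometry_zero_regular : regular_factorization S O.
Proof.
have SO : S \o O = O by apply/funext => x /=; exact: linear0.
exists (fun x => (0, x)).
  split; rewrite ?SO.
  - move=> x _; split; last exact: defect_space_zero.
    exact: defect_space0 isometry_contractive.
  - by move=> a x y _ _; rewrite -[RHS]/(a *: 0 + 0, a *: x + y) scaler0 addr0.
  - by move=> x _ /=; rewrite normr0 expr0n/= add0r.
  - by move=> h; rewrite defect_isometry.
apply/seteqP; split=> [_ [x _ <-]|[x y] [/= /defect_space_isometry -> _]].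
  split; last exact: defect_space_zero.
  exact: defect_space0 isometry_contractive.
by exists y => //; rewrite SO; exact: defect_space_zero.
Qed.

(** For y outside the range of [S], the pair (D_0 y, 0) is missed: a preimage D_0 h would give D_0 S
    h = D_0 y, and applying D_0 yields S h = y. *)
Lemma zero_isometry_not_regular (y : H) :
  (forall x, S x != y) -> ~ regular_factorization O S.
Proof.
move=> yS [Z [_ _ _ ZD] Zonto].
have : (defect_space O `*` defect_space S) (defect_operator O y, 0).
  by split; [exact: defect_space_zero | exact: defect_space0 isometry_contractive].
rewrite -Zonto => -[x _]; rewrite -[x]defect_zeroK.
(* Holds by conversion, as 0 after [S] computes to the zero map; the opposite order requires
   linearity of [S]. *)
have -> : defect_operator O = defect_operator (O \o S) by [].
rewrite ZD => -[] /(congr1 (defect_operator O)).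
rewrite !defect_zeroK => e _; have := yS (defect_operator O x).
by rewrite -e eqxx.
Qed.

End isometry_zero.

Theorem theorem3p1 (R : realType) :
  (forall (H : hilbertType R) (T1 T2 : {linear H -> H}),
      contractive T1 -> contractive T2 ->
      T1 \o T2 =1 T2 \o T1 ->
      finite_dimensional (defect_space (T1 \o T2)) ->
      finite_dimensional (defect_space T1) ->
      finite_dimensional (defect_space T2) ->
      (regular_factorization T1 T2 <-> regular_factorization T2 T1)) /\
  (exists (H : hilbertType R) (T1 T2 : {linear H -> H}),
      [/\ contractive T1, contractive T2,
          T1 \o T2 =1 T2 \o T1
        & (regular_factorization T1 T2 /\ ~ regular_factorization T2 T1) \/
          (regular_factorization T2 T1 /\ ~ regular_factorization T1 T2)]).
Proof.
split=> [H T1 T2 c1 c2 T12 fd _ _|].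
  split; first exact: regular_factorization_comm.
  by apply: regular_factorization_comm => //; rewrite -(funext T12).
have [y hy] := shift_not_onto R.
exists (l2 R), (shift (R := R)), \0; split.
- exact: isometry_contractive (@shift_isometry R).
- exact: zero_contractive.
- by move=> x /=; rewrite linear0.
- left; split; first exact: isometry_zero_regular (@shift_isometry R).
  exact: (zero_isometry_not_regular (@shift_isometry R) hy).
Qed.
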